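(* The system $\mathsf{DG}$ proves $\neg\mathsf{CT}^{\mathrm{st}}$, where Church's thesis $\mathsf{CT}$ is $(\forall f^{1})(\exists e^{0})(\forall n^{0},m^{0})\big[(\exists s^{0})(\varphi_{e,s}(n)=m)\leftrightarrow f(n)=m\big]$ and $\mathsf{CT}^{\mathrm{st}}$ is $(\forall^{\mathrm{st}} f^{1})(\exists^{\mathrm{st}} e^{0})(\forall^{\mathrm{st}} n^{0},m^{0})\big[(\exists^{\mathrm{st}} s^{0})(\varphi_{e,s}(n)=m)\leftrightarrow f(n)=m\big]$.
   Context: $\varphi_{e,s}(n)=m$ is the primitive recursive predicate expressing that the Turing machine with index $e$ on input $n$ halts within at most $s$ steps with output $m$. Finite types: $0$ is a type and if $\rho,\sigma$ are types so is $\rho\to\sigma$; type $1=0\to0$, $2=1\to0$. $\mathsf{E\text{-}HA}^{\omega}$ is Heyting arithmetic in all finite types (intuitionistic logic, Gödel's $T$ constants) with extensionality. Equality $=_0$ is primitive; for $\tau=\tau_1\to\dots\to\tau_k\to0$, $x=_\tau y$ abbreviates $(\forall z_1\dots z_k)(xz_1\dots z_k=_0yz_1\dots z_k)$, and $\le_\tau$ likewise. Extensionality $(\mathsf E_{\rho\to\tau})$: $(\forall\varphi)(\forall x,y)(x=_\rho y\to\varphi(x)=_\tau\varphi(y))$, for all types. Strong majorizability (Howard–Bezem): $x\le^*_0 y$ iff $x\le_0 y$; $x\le^*_{\rho\to\sigma}y$ iff for all $u,v$ with $u\le^*_\rho v$: $xu\le^*_\sigma yv$ and $yu\le^*_\sigma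 yv$. Monotone: $x\le^*x$; $\tilde\forall,\tilde\exists$ range over monotone objects. The language of $\mathsf{DG}$ adds predicates $\mathrm{st}^\sigma$ (''is standard''); $\forall^{\mathrm{st}},\exists^{\mathrm{st}}$ are the relativised quantifiers, $\tilde\forall^{\mathrm{st}},\tilde\exists^{\mathrm{st}}$ combine both restrictions. Internal = not containing $\mathrm{st}$. $\mathsf{DG}$ is $\mathsf{E\text{-}HA}^\omega$ in the extended language plus: (a) $x=_\sigma y\to(\mathrm{st}(x)\to\mathrm{st}(y))$; (b) $\mathrm{st}(y)\to(x\le^*_\sigma y\to\mathrm{st}(x))$; (c) $\mathrm{st}(t)$ for closed terms $t$; (d) $\mathrm{st}(z)\to(\mathrm{st}(x)\to\mathrm{st}(zx))$; external induction $\Phi(0)\wedge(\forall^{\mathrm{st}}n)(\Phi(n)\to\Phi(n+1))\to(\forall^{\mathrm{st}}n)\Phi(n)$ for any $\Phi$; and for arbitrary $\Phi,\Psi$ and internal $\phi,\psi$: $\mathsf{mAC}^\omega$: $(\tilde\forall^{\mathrm{st}}x)(\tilde\exists^{\mathrm{st}}y)\Phi(x,y)\to(\tilde\exists^{\mathrm{st}}f)(\tilde\forall^{\mathrm{st}}x)(\exists y\le^*f(x))\Phi(x,y)$; $\mathsf R^\omega$: $(\forall x)(\exists^{\mathrm{st}}y)\Phi(x,y)\to(\tilde\exists^{\mathrm{st}}z)(\forall x)(\exists y\le^*z)\Phi(x,y)$; $\mathsf I^\omega$: $(\tilde\forall^{\mathrm{st}}z)(\exists x)(\forall y\le^*z)\phi(x,y)\to(\exists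 x)(\forall^{\mathrm{st}}y)\phi(x,y)$; $\mathsf{IP}^\omega_{\tilde\forall^{\mathrm{st}}}$: $[(\tilde\forall^{\mathrm{st}}x)\phi(x)\to(\tilde\exists^{\mathrm{st}}y)\Psi(y)]\to(\tilde\exists^{\mathrm{st}}z)[(\tilde\forall^{\mathrm{st}}x)\phi(x)\to(\tilde\exists y\le^*z)\Psi(y)]$; $\mathsf M^\omega$: $[(\tilde\forall^{\mathrm{st}}x)\phi(x)\to\psi]\to(\tilde\exists^{\mathrm{st}}y)[(\forall x\le^*y)\phi(x)\to\psi]$; $\mathsf{MAJ}^\omega$: $(\forall^{\mathrm{st}}x)(\exists^{\mathrm{st}}y)(x\le^*y)$. *)

(* Defs.v *)
From mathcomp Require Import all_boot.
From mathcomp Require Import zify.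
From Stdlib Require List.

Set Implicit Arguments.
Unset Strict Implicit.
Unset Printing Implicit Defensive.

(* [tm G s] below: terms of Goedel's T of type [s] with (de Bruijn) free
   variables declared in [G]. *)

Inductive ty : Type := N | Arr (s t : ty).

Declare Scope dg_scope.
Delimit Scope dg_scope with dg.
Local Open Scope dg_scope.

Notation "s ~> t" := (Arr s t) (at level 55, right associativity) : dg_scope.

Definition ctx := seq ty.

Inductive var : ctx -> ty -> Type :=
  | vz G s : var (s :: G) s
  | vs G s t : var G t -> var (s :: G) t.
Arguments vz {G s}.
Arguments vs {G s t} x.

Definition vcase G s (P : forall t, var (s :: G) t -> Type)
    (Pz : P s vz) (Ps : forall t (x : var G t), P t (vs x)) :
    forall t (x : var (s :: G) t), P t x :=
  fun t x =>
    match x as x0 in var G0 t0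
      return match G0 return var G0 t0 -> Type with
             | [::] => fun _ => unit
             | s1 :: G1 => fun y => forall P1 : forall t, var (s1 :: G1) t -> Type,
                 P1 s1 vz -> (forall t (z : var G1 t), P1 t (vs z)) -> P1 t0 y
             end x0
    with
    | vz _ _ => fun _ pz _ => pz
    | vs _ _ _ y => fun _ _ ps => ps _ y
    end P Pz Ps.

Definition vnil (P : forall t, var [::] t -> Type) t (x : var [::] t) : P t x :=
  match x as x0 in var G0 t0
    return match G0 return var G0 t0 -> Type with
           | [::] => P t0
           | _ :: _ => fun _ => unit
           end x0
  with
  | vz _ _ => tt
  | vs _ _ _ _ => tt
  end.

Arguments vcase {G s} P Pz Ps t x.
Arguments vnil P t x : clear implicits.

Inductive tm (G : ctx) : ty -> Type :=
  | Var s : var G s -> tm G s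
  | App s t : tm G (s ~> t) -> tm G s -> tm G t
  | Zero : tm G N
  | Succ : tm G (N ~> N)
  | Pi s t : tm G (s ~> t ~> s)
  | Sigma r s t : tm G ((r ~> s ~> t) ~> (r ~> s) ~> r ~> t)
  | Rec s : tm G (N ~> s ~> (s ~> N ~> s) ~> s).
Arguments Zero {G}.
Arguments Succ {G}.
Arguments Pi {G s t}.
Arguments Sigma {G r s t}.
Arguments Rec {G s}.

Notation "t $ u" := (App t u) (at level 40, left associativity) : dg_scope.
Notation v0 := (Var vz).
Notation v1 := (Var (vs vz)).
Notation v2 := (Var (vs (vs vz))).
Notation v3 := (Var (vs (vs (vs vz)))).

Definition tsubst G D := forall s, var G s -> tm D s.

(* Terms contain no binders. *)
Fixpoint tsub G D (f : tsubst G D) s (t : tm G s) : tm D s :=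
  match t in tm _ s0 return tm D s0 with
  | Var _ x => f _ x
  | App _ _ t u => tsub f t $ tsub f u
  | Zero => Zero
  | Succ => Succ
  | Pi _ _ => Pi
  | Sigma _ _ _ => Sigma
  | Rec _ => Rec
  end.

Definition shift G r : tsubst G (r :: G) := fun s x => Var (vs x).
Definition twk G r s (t : tm G s) : tm (r :: G) s := tsub (@shift G r) t.
Definition cl G s (t : tm [::] s) : tm G s :=
  tsub (vnil (fun s _ => tm G s)) t.
Arguments cl {G s} t.

Definition scons G D r (t : tm D r) (f : tsubst G D) : tsubst (r :: G) D :=
  vcase (fun s _ => tm D s) t f.
Definition inst G r (t : tm G r) : tsubst (r :: G) G := scons t (@Var G).
Definition up G D r (f : tsubst G D) : tsubst (r :: G) (r :: D) :=
  scons v0 (fun s x => twk r (f s x)).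

Arguments shift G r s x : clear implicits.
Arguments scons {G D r} t f s x.
Arguments inst {G r} t s x.
Arguments up {G D} r f s x.

Fixpoint lam G r s (t : tm (r :: G) s) : tm G (r ~> s) :=
  match t in tm _ s0 return tm G (r ~> s0) with
  | Var _ x =>
      vcase (fun s _ => tm G (r ~> s))
        (Sigma $ Pi $ (Pi : tm G (r ~> r ~> r)))
        (fun s (y : var G s) => Pi $ Var y) _ x
  | App _ _ t u => Sigma $ lam t $ lam u
  | Zero => Pi $ Zero
  | Succ => Pi $ Succ
  | Pi _ _ => Pi $ Pi
  | Sigma _ _ _ => Pi $ Sigma
  | Rec _ => Pi $ Rec
  end.

(* In [z], [v0] is the recursion counter and [v1] the previous value. *)
Definition rec0 G (n y : tm G N) (z : tm [:: N, N & G] N) : tm G N :=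
  Rec $ n $ y $ lam (lam z).

(* In the closed terms below only recursion at type 0 is used, so they define
   primitive recursive functions. *)

Definition tpred : tm [::] (N ~> N) := lam (rec0 v0 Zero v0).
Definition tmonus : tm [::] (N ~> N ~> N) :=
  lam (lam (rec0 v0 v1 (cl tpred $ v1))).
Definition tplus : tm [::] (N ~> N ~> N) := lam (lam (rec0 v1 v0 (Succ $ v1))).
Definition tmul : tm [::] (N ~> N ~> N) :=
  lam (lam (rec0 v1 Zero (cl tplus $ v2 $ v1))).
Definition tdbl : tm [::] (N ~> N) := lam (cl tplus $ v0 $ v0).
Definition tpow2 : tm [::] (N ~> N) := lam (rec0 v0 (Succ $ Zero) (cl tdbl $ v1)).
(* [tif $ x $ a $ b] is [a] if [x = 0] and [b] otherwise. *)
Definition tif : tm [::] (N ~> N ~> N ~> N) := lam (lam (lam (rec0 v2 v1 v2))).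
Definition todd : tm [::] (N ~> N) :=
  lam (rec0 v0 Zero (cl tif $ v1 $ (Succ $ Zero) $ Zero)).
Definition thalf : tm [::] (N ~> N) :=
  lam (rec0 v0 Zero (cl tplus $ (cl todd $ v0) $ v1)).
(* [tshr $ x $ i] is the quotient of [x] by [2 ^ i]. *)
Definition tshr : tm [::] (N ~> N ~> N) :=
  lam (lam (rec0 v0 v1 (cl thalf $ v1))).
(* The number of digits 1 in the binary expansion. *)
Definition tones : tm [::] (N ~> N) :=
  lam (rec0 v0 Zero (cl tplus $ (cl todd $ (cl tshr $ v2 $ v0)) $ v1)).

(* [CodeSeq.code (x :: s) = 2 ^ x * (CodeSeq.code s).*2.+1] and
   [CodeSeq.code [::] = 0]; the head of a nonempty sequence is the 2-adic
   valuation of its code, found here by bounded search. *)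
Definition tcons : tm [::] (N ~> N ~> N) :=
  lam (lam (cl tmul $ (cl tpow2 $ v1) $ (Succ $ (cl tdbl $ v0)))).
Definition thead : tm [::] (N ~> N) :=
  lam (rec0 v0 Zero
    (cl tif $ (cl todd $ (cl tshr $ v2 $ v1)) $ (Succ $ v1) $ v1)).
Definition ttail : tm [::] (N ~> N) :=
  lam (cl thalf $ (cl tshr $ v0 $ (cl thead $ v0))).
Definition tnth : tm [::] (N ~> N ~> N) :=
  lam (lam (cl thead $ (rec0 v0 v1 (cl ttail $ v1)))).

(* Turing machines: two-way infinite tape over {blank = false, mark = true}, states in [nat],
   initial state 0.  The tape is [rev left ++ right], surrounded by blanks, and
   the head scans the first cell of [right].  The index [e] codes the program
   [CodeSeq.decode e], whose entry of rank [2 * q + b] is the instruction for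
   state [q] and scanned symbol [b]: 0 (also the default) means "halt", and
   [4 * q' + 2 * w + d + 1] means "write [w], move right if [d = 1] and left if
   [d = 0], go to state [q']". *)

Record config := Config { state : nat; left : seq bool; right : seq bool }.

Definition instr := (bool * bool * nat)%type.

Definition decode_instr (a : nat) : option instr :=
  if a is k.+1 then Some (odd k./2, odd k, k./2./2) else None.

Definition TM_next (e : nat) (c : config) : option instr :=
  decode_instr (nth 0 (CodeSeq.decode e) ((state c).*2 + head false (right c))).

Definition TM_step (e : nat) (c : config) : config :=
  match TM_next e c with
  | None => c
  | Some (w, true, q) => Config q (w :: left c) (behead (right c))
  | Some (w, false, q) =>
      Config q (behead (left c)) (head false (left c) :: w :: behead (right c))
  end.

(* Input [n] is a block of [n.+1] marks, with the head on the leftmost one; the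
   output is the number of marks on the tape when the machine halts. *)
Definition TM_init (n : nat) : config := Config 0 [::] (nseq n.+1 true).
Definition TM_output (c : config) : nat := count id (left c) + count id (right c).

(* A halted configuration is a fixed point of [TM_step]. *)
Definition TM_halts (e s n m : nat) : Prop :=
  let c := iter s (TM_step e) (TM_init n) in
  TM_next e c = None /\ TM_output c = m.

(* The same function as a closed term: a tape half is read as the binary number
   whose least significant digit is next to the head, and the configuration
   [(q, l, r)] is coded by [tcons $ q $ (tcons $ l $ r)]. *)

Definition tst : tm [::] (N ~> N) := thead.
Definition tleft : tm [::] (N ~> N) := lam (cl thead $ (cl ttail $ v0)).
Definition tright : tm [::] (N ~> N) := lam (cl ttail $ (cl ttail $ v0)).
Definition tconf : tm [::] (N ~> N ~> N ~> N) :=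
  lam (lam (lam (cl tcons $ v2 $ (cl tcons $ v1 $ v0)))).

Definition tnext : tm [::] (N ~> N ~> N) :=
  lam (lam (cl tnth $ v1 $
    (cl tplus $ (cl tdbl $ (cl tst $ v0)) $ (cl todd $ (cl tright $ v0))))).

(* [texec $ k $ c]: execute the instruction coded by [k.+1]. *)
Definition texec : tm [::] (N ~> N ~> N) :=
  lam (lam
    (let w := cl todd $ (cl thalf $ v1) in
     let d := cl todd $ v1 in
     let q := cl thalf $ (cl thalf $ v1) in
     let l := cl tleft $ v0 in
     let r := cl tright $ v0 in
     let push b x := cl tplus $ b $ (cl tdbl $ x) in
     cl tif $ d
       $ (cl tconf $ q $ (cl thalf $ l)
            $ (push (cl todd $ l) (push w (cl thalf $ r))))
       $ (cl tconf $ q $ (push w l) $ (cl thalf $ r)))).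

Definition tstep : tm [::] (N ~> N ~> N) :=
  lam (lam
    (let a := cl tnext $ v1 $ v0 in
     cl tif $ a $ v0 $ (cl texec $ (cl tpred $ a) $ v0))).

Definition tinit : tm [::] (N ~> N) :=
  lam (cl tconf $ Zero $ Zero $ (cl tpred $ (cl tpow2 $ (Succ $ v0)))).

Definition trun : tm [::] (N ~> N ~> N ~> N) :=
  lam (lam (lam (rec0 v1 (cl tinit $ v0) (cl tstep $ Var (vs (vs (vs (vs vz)))) $ v1)))).

(* [tTM $ e $ s $ n] is 0 if machine [e] on input [n] has not halted within [s]
   steps, and 1 plus its output otherwise. *)
Definition tTM : tm [::] (N ~> N ~> N ~> N) :=
  lam (lam (lam
    (let c := cl trun $ v2 $ v1 $ v0 in
     cl tif $ (cl tnext $ v2 $ c)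
       $ (Succ $ (cl tplus $ (cl tones $ (cl tleft $ c)) $ (cl tones $ (cl tright $ c))))
       $ Zero))).

Fixpoint dty (s : ty) : Type := if s is Arr s t then dty s -> dty t else nat.

Definition env (G : ctx) := forall s, var G s -> dty s.
Definition enil : env [::] := vnil (fun s _ => dty s).
Definition econs G r (a : dty r) (E : env G) : env (r :: G) :=
  vcase (fun s _ => dty s) a E.

Arguments econs {G r} a E s x.

Fixpoint den G (E : env G) s (t : tm G s) : dty s :=
  match t in tm _ s0 return dty s0 with
  | Var _ x => E _ x
  | App _ _ t u => (den E t) (den E u)
  | Zero => 0
  | Succ => S
  | Pi _ _ => fun x _ => x
  | Sigma _ _ _ => fun x y z => x z (y z)
  | Rec _ => fun n y z => nat_rect _ y (fun k p => z p k) n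
  end.

Definition vden s (t : tm [::] s) : dty s := den enil t.

Lemma den_lam G (E : env G) r s (t : tm (r :: G) s) a :
  den E (lam t) a = den (econs a E) t.
Proof.
elim: t => //= [t x | t1 t2 t IHt u IHu]; last by rewrite IHt IHu.
by refine (vcase (fun t x => den E (lam (Var x)) a = econs a E _ x) _ _ _ x).
Qed.

Lemma den_cl G (E : env G) s (t : tm [::] s) : den E (cl t) = vden t.
Proof.
rewrite /cl /vden; elim: t => //= [t x | t1 t2 t IHt u IHu]; last by rewrite IHt IHu.
by refine (vnil (fun t x => den E (cl (Var x)) = enil x) _ x).
Qed.

Lemma den_rec0 G (E : env G) (n y : tm G N) z :
  den E (rec0 n y z) =
  nat_rect (fun _ => nat) (den E y)
    (fun k p => den (econs (r := N) k (econs (r := N) p E)) z) (den E n).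
Proof.
by rewrite /rec0 /=; elim: (den E n) => //= k ->; rewrite !den_lam.
Qed.

Lemma den_app G (E : env G) s t (u : tm G (s ~> t)) v :
  den E (u $ v) = den E u (den E v).
Proof. by []. Qed.

Lemma den_v0 G (E : env G) r a : den (econs (r := r) a E) v0 = a.
Proof. by []. Qed.

Lemma den_vs G (E : env G) r s a (x : var G s) :
  den (econs (r := r) a E) (Var (vs x)) = den E (Var x).
Proof. by []. Qed.

Lemma den_Zero G (E : env G) : den E Zero = 0.
Proof. by []. Qed.

Lemma den_Succ G (E : env G) x : den E Succ x = x.+1.
Proof. by []. Qed.

Definition denE := (den_lam, den_cl, den_rec0, den_app, den_v0, den_vs, den_Zero, den_Succ).

#[local] Opaque cl lam rec0.
#[local] Arguments den : simpl never.
#[local] Arguments vden : simpl never.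
#[local] Arguments econs : simpl never.

Local Ltac dsimp := rewrite /vden ?denE.

Lemma tpredE x : vden tpred x = x.-1.
Proof. by dsimp; case: x. Qed.

Lemma tmonusE x y : vden tmonus x y = x - y.
Proof.
by dsimp; elim: y => [|y IHy] /=; rewrite ?subn0 // ?denE tpredE IHy subnS.
Qed.

Lemma tplusE x y : vden tplus x y = x + y.
Proof. by dsimp; elim: x => //= x ->. Qed.

Lemma tmulE x y : vden tmul x y = x * y.
Proof. by dsimp; elim: x => //= x IHx; rewrite ?denE tplusE IHx mulSn. Qed.

Lemma tdblE x : vden tdbl x = x.*2.
Proof. by dsimp; rewrite tplusE addnn. Qed.

Lemma tpow2E x : vden tpow2 x = 2 ^ x.
Proof. by dsimp; elim: x => //= x IHx; rewrite ?denE tdblE IHx expnS mul2n. Qed.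

Lemma tifE x a b : vden tif x a b = if x == 0 then a else b.
Proof. by dsimp; case: x. Qed.

Lemma toddE x : vden todd x = odd x.
Proof. by dsimp; elim: x => //= x IHx; rewrite ?denE tifE IHx; case: odd. Qed.

Lemma thalfE x : vden thalf x = x./2.
Proof.
by dsimp; elim: x => //= x IHx; rewrite ?denE tplusE toddE IHx uphalf_half.
Qed.

Definition shr x i := iter i half x.

Lemma tshrE x i : vden tshr x i = shr x i.
Proof. by dsimp; elim: i => //= i IHi; rewrite ?denE thalfE IHi. Qed.

Definition ones x := \sum_(i < x) odd (shr x i).

Lemma tonesE x : vden tones x = ones x.
Proof.
dsimp; set F := (F in nat_rect _ _ F _).
suff /(_ x) : forall k, nat_rect _ 0 F k = \sum_(i < k) odd (shr x i) by [].
elim=> [|k IHk] /=; first by rewrite big_ord0.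
by rewrite {1}/F !denE tplusE toddE tshrE IHk big_ord_recr addnC.
Qed.

Lemma shr_exp k u : shr (2 ^ k * u) k = u.
Proof.
rewrite /shr; elim: k => [|k IHk]; first by rewrite mul1n.
by rewrite iterSr expnS -mulnA mul2n doubleK.
Qed.

Lemma tconsE x m : vden tcons x m = 2 ^ x * m.*2.+1.
Proof. by dsimp; rewrite ?denE tmulE tpow2E tdblE. Qed.

Lemma theadE x m : vden thead (2 ^ x * m.*2.+1) = x.
Proof.
dsimp; set c := 2 ^ x * _.
have ltxc: x < c by rewrite (leq_trans (ltn_expl x (isT : 1 < 2))) // leq_pmulr.
have oddP i : i <= x -> odd (shr c i) = (i == x).
  move=> lix; rewrite /c -{1}(subnKC lix) expnD -mulnA shr_exp oddM oddX.
  by rewrite /= odd_double /= andbT orbF subn_eq0 eqn_leq lix.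
set F := (F in nat_rect _ _ F _).
suff /(_ c) -> : forall k, nat_rect _ 0 F k = minn k x by apply/minn_idPr/ltnW.
elim=> [|k IHk] /=; first by rewrite min0n.
rewrite IHk {1}/F !denE tifE toddE tshrE oddP ?geq_minr //.
by case: eqP => /=; lia.
Qed.

Lemma thead0 : vden thead 0 = 0.
Proof. by dsimp. Qed.

Lemma ttailE x m : vden ttail (2 ^ x * m.*2.+1) = m.
Proof. by dsimp; rewrite ?denE thalfE tshrE theadE shr_exp /= uphalf_double. Qed.

Lemma ttail0 : vden ttail 0 = 0.
Proof. by dsimp; rewrite ?denE thalfE tshrE thead0. Qed.

Lemma tnthE e i : vden tnth e i = nth 0 (CodeSeq.decode e) i.
Proof.
rewrite -{1}[e]CodeSeq.decodeK; move: (CodeSeq.decode e) => s.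
dsimp; set F := (F in nat_rect _ _ F _).
have -> : forall k, nat_rect _ (CodeSeq.code s) F k = CodeSeq.code (drop k s).
  elim=> [|k IHk] /=; first by rewrite drop0.
  rewrite IHk {1}/F ?denE -[in RHS]add1n -drop_drop.
  by case: (drop k s) => [|x t]; rewrite /= ?ttail0 ?ttailE ?drop0.
rewrite -[i in RHS]addn0 -nth_drop.
by case: (drop i s) => [|x t]; rewrite /= ?thead0 // theadE.
Qed.

Definition cnf q l r := vden tconf q l r.

Lemma cnf_def q l r : cnf q l r = 2 ^ q * (2 ^ l * r.*2.+1).*2.+1.
Proof. by rewrite /cnf; dsimp; rewrite ?denE !tconsE. Qed.

Lemma tstE q l r : vden tst (cnf q l r) = q.
Proof. by rewrite cnf_def theadE. Qed.

Lemma tleftE q l r : vden tleft (cnf q l r) = l.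
Proof. by dsimp; rewrite ?denE cnf_def ttailE theadE. Qed.

Lemma trightE q l r : vden tright (cnf q l r) = r.
Proof. by dsimp; rewrite ?denE cnf_def !ttailE. Qed.

Definition bits (s : seq bool) : nat := foldr (fun (b : bool) m => b + m.*2) 0 s.

Lemma odd_bits s : odd (bits s) = head false s.
Proof. by case: s => //= b s; rewrite oddD odd_double addbF oddb. Qed.

Lemma half_bits s : (bits s)./2 = bits (behead s).
Proof. by case: s => //= b s; rewrite half_bit_double. Qed.

Lemma shr_bits s i : shr (bits s) i = bits (drop i s).
Proof.
rewrite /shr; elim: i => [|i IHi]; first by rewrite drop0.
by rewrite iterS IHi half_bits -drop1 drop_drop.
Qed.

Lemma ones_bits s : ones (bits s) = count id s.
Proof.
have -> : ones (bits s) = \sum_(i < bits s) head false (drop i s).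
  by apply: eq_bigr => i _; rewrite shr_bits odd_bits.
suff H k : bits s <= k -> \sum_(i < k) head false (drop i s) = count id s by apply: H.
elim: s k => [|b s IHs] [|k] /=.
- by rewrite big_ord0.
- by move=> _; rewrite big1.
- rewrite leqn0 addn_eq0 double_eq0 => /andP[/eqP-> /eqP s0].
  by rewrite big_ord0 -(IHs 0) ?s0 ?big_ord0.
- move=> lebsk; rewrite big_ord_recl /=; congr (_ + _); apply: IHs; lia.
Qed.

Definition enc (c : config) : nat := cnf (state c) (bits (left c)) (bits (right c)).

Lemma tnextE e c : vden tnext e (enc c) =
  nth 0 (CodeSeq.decode e) ((state c).*2 + head false (right c)).
Proof.
by dsimp; rewrite ?denE tnthE tplusE tdblE toddE tstE trightE odd_bits.
Qed.

Lemma TM_nextE e c : TM_next e c = decode_instr (vden tnext e (enc c)).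
Proof. by rewrite tnextE. Qed.

Lemma texecE k c : vden texec k (enc c) =
  enc (if odd k then Config k./2./2 (odd k./2 :: left c) (behead (right c))
       else Config k./2./2 (behead (left c))
              [:: head false (left c), odd k./2 & behead (right c)]).
Proof.
dsimp; rewrite ?denE !tplusE !tdblE !toddE !thalfE.
rewrite !tleftE !trightE !half_bits odd_bits tifE.
by case: (odd k).
Qed.

Lemma tstepE e c : vden tstep e (enc c) = enc (TM_step e c).
Proof.
dsimp; rewrite ?denE tpredE tifE /TM_step TM_nextE.
case: (vden tnext e (enc c)) => [|k] //=.
by rewrite texecE; case: (odd k).
Qed.

Lemma bits_nseq n : bits (nseq n true) = (2 ^ n).-1.
Proof.
elim: n => //= n ->; rewrite expnS mul2n.
by have := expn_gt0 2 n; case: (2 ^ n).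
Qed.

Lemma tinitE n : vden tinit n = enc (TM_init n).
Proof.
rewrite /enc /TM_init [bits (right _)]bits_nseq.
by dsimp; rewrite tpredE tpow2E.
Qed.

Lemma trunE e s n :
  vden trun e s n = enc (iter s (TM_step e) (TM_init n)).
Proof.
dsimp; rewrite tinitE; set F := (F in nat_rect _ _ F _).
suff /(_ s) : forall k, nat_rect _ (enc (TM_init n)) F k =
  enc (iter k (TM_step e) (TM_init n)) by [].
by elim=> // k IHk; rewrite iterS -tstepE -IHk [LHS]/= {1}/F ?denE.
Qed.

Lemma tTM_correct e s n m : vden tTM e s n = m.+1 <-> TM_halts e s n m.
Proof.
dsimp; rewrite ?denE trunE /TM_halts TM_nextE tifE.
case: (vden tnext _ _) => [|k] /=; last by split=> // -[].
rewrite tplusE !tonesE tleftE trightE !ones_bits /TM_output.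
by split=> [[]|[_ ->]].
Qed.

#[local] Transparent cl lam rec0.

Inductive form (G : ctx) : Type :=
  | Bot
  | Eq0 of tm G N & tm G N
  | St s of tm G s
  | And of form G & form G
  | Or of form G & form G
  | Imp of form G & form G
  | All s of form (s :: G)
  | Ex s of form (s :: G).
Arguments Bot {G}.
Arguments All {G s} _.
Arguments Ex {G s} _.

Notation "t === u" := (Eq0 t u) (at level 60, no associativity) : dg_scope.
Notation "A &&& B" := (And A B) (at level 65, right associativity) : dg_scope.
Notation "A ||| B" := (Or A B) (at level 66, right associativity) : dg_scope.
Notation "A ==>> B" := (Imp A B) (at level 67, right associativity) : dg_scope.
Definition Neg G (A : form G) := A ==>> Bot.
Definition Iff G (A B : form G) := (A ==>> B) &&& (B ==>> A).
Notation "A <<=>> B" := (Iff A B) (at level 68, no associativity) : dg_scope.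

Fixpoint internal G (A : form G) : bool :=
  match A with
  | Bot | Eq0 _ _ => true
  | St _ _ => false
  | And A B | Or A B | Imp A B => internal A && internal B
  | All _ A | Ex _ A => internal A
  end.

Fixpoint fsub G D (f : tsubst G D) (A : form G) : form D :=
  match A with
  | Bot => Bot
  | Eq0 t u => tsub f t === tsub f u
  | St _ t => St (tsub f t)
  | And A B => fsub f A &&& fsub f B
  | Or A B => fsub f A ||| fsub f B
  | Imp A B => fsub f A ==>> fsub f B
  | All s A => All (fsub (up s f) A)
  | Ex s A => Ex (fsub (up s f) A)
  end.

(* [fwk], [fwk1] and [fwk2] insert an unused variable at position 0, 1 and 2. *)
Definition fwk G r (A : form G) : form (r :: G) := fsub (shift G r) A.
Definition fwk1 G r s (A : form (s :: G)) : form [:: s, r & G] :=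
  fsub (up s (shift G r)) A.
Definition fwk2 G r s t (A : form [:: t, s & G]) : form [:: t, s, r & G] :=
  fsub (up t (up s (shift G r))) A.

Definition inst_form G r (A : form (r :: G)) (t : tm G r) : form G :=
  fsub (inst t) A.
(* A(n) |-> A(n + 1) *)
Definition succ_form G (A : form (N :: G)) : form (N :: G) :=
  fsub (scons (Succ $ v0) (shift G N)) A.

Fixpoint eqT G (s : ty) : tm G s -> tm G s -> form G :=
  match s return tm G s -> tm G s -> form G with
  | N => fun x y => x === y
  | Arr r t => fun x y => All (eqT (twk r x $ v0) (twk r y $ v0))
  end.
Notation "x =*= y" := (eqT x y) (at level 60, no associativity) : dg_scope.

Definition le0 G (x y : tm G N) : form G := cl tmonus $ x $ y === Zero.

(* Strong majorizability; in the arrow case [u] is [v1] and [v] is [v0]. *)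
Fixpoint maj G (s : ty) : tm G s -> tm G s -> form G :=
  match s return tm G s -> tm G s -> form G with
  | N => fun x y => le0 x y
  | Arr r t => fun x y =>
      let x' := twk r (twk r x) in
      let y' := twk r (twk r y) in
      All (All (maj v1 v0 ==>> maj (x' $ v1) (y' $ v0) &&& maj (y' $ v1) (y' $ v0)))
  end.
Notation "x <=* y" := (maj x y) (at level 60, no associativity) : dg_scope.

(* Relativised quantifiers: suffix [st] for standard, [m] for monotone, and
   [le t] for [<=* t]. *)
Definition All_st G s (A : form (s :: G)) := All (St v0 ==>> A).
Definition Ex_st G s (A : form (s :: G)) := Ex (St v0 &&& A).
Definition All_mst G s (A : form (s :: G)) := All (St v0 ==>> v0 <=* v0 ==>> A).
Definition Ex_mst G s (A : form (s :: G)) := Ex (St v0 &&& v0 <=* v0 &&& A).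
Definition All_le G s (t : tm G s) (A : form (s :: G)) :=
  All (v0 <=* twk s t ==>> A).
Definition Ex_le G s (t : tm G s) (A : form (s :: G)) :=
  Ex (v0 <=* twk s t &&& A).
Definition Ex_mle G s (t : tm G s) (A : form (s :: G)) :=
  Ex (v0 <=* v0 &&& v0 <=* twk s t &&& A).

(* Axioms are stated for arbitrary terms and formulas with parameters in [G].
   In a formula [A : form [:: t, s & G]] standing for Phi(x, y), [x] is [v1]
   and [y] is [v0]. *)

Inductive DG_axiom G : form G -> Prop :=
  | ax_refl (x : tm G N) : DG_axiom (x === x)
  | ax_sym (x y : tm G N) : DG_axiom (x === y ==>> y === x)
  | ax_trans (x y z : tm G N) : DG_axiom (x === y ==>> y === z ==>> x === z)
  | ax_succ_neq0 (x : tm G N) : DG_axiom (Neg (Succ $ x === Zero))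
  | ax_succ_inj (x y : tm G N) : DG_axiom (Succ $ x === Succ $ y ==>> x === y)
  | ax_Pi s t (x : tm G s) (y : tm G t) : DG_axiom (Pi $ x $ y =*= x)
  | ax_Sigma r s t (x : tm G (r ~> s ~> t)) (y : tm G (r ~> s)) (z : tm G r) :
      DG_axiom (Sigma $ x $ y $ z =*= x $ z $ (y $ z))
  | ax_Rec0 s (y : tm G s) (z : tm G (s ~> N ~> s)) :
      DG_axiom (Rec $ Zero $ y $ z =*= y)
  | ax_RecS s (n : tm G N) (y : tm G s) (z : tm G (s ~> N ~> s)) :
      DG_axiom (Rec $ (Succ $ n) $ y $ z =*= z $ (Rec $ n $ y $ z) $ n)
  | ax_ext s t (f : tm G (s ~> t)) (x y : tm G s) :
      DG_axiom (x =*= y ==>> f $ x =*= f $ y)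
  (* Induction of E-HA^omega: internal formulas only.  For formulas containing
     [St] it would make every number standard, contradicting [ax_I]. *)
  | ax_ind (A : form (N :: G)) : internal A ->
      DG_axiom
        (inst_form A Zero &&& All (A ==>> succ_form A) ==>> All A)
  | ax_st_eq s (x y : tm G s) : DG_axiom (x =*= y ==>> St x ==>> St y)
  | ax_st_maj s (x y : tm G s) : DG_axiom (St y ==>> x <=* y ==>> St x)
  | ax_st_closed s (t : tm [::] s) : DG_axiom (St (cl t))
  | ax_st_app s t (z : tm G (s ~> t)) (x : tm G s) :
      DG_axiom (St z ==>> St x ==>> St (z $ x))
  | ax_ind_st (A : form (N :: G)) :
      DG_axiom
        (inst_form A Zero &&& All_st (A ==>> succ_form A) ==>> All_st A)
  | ax_mAC s t (A : form [:: t, s & G]) :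
      DG_axiom
        (All_mst (Ex_mst A) ==>>
         Ex_mst (s := s ~> t) (All_mst (Ex_le (v1 $ v0) (fwk2 (s ~> t) A))))
  | ax_R s t (A : form [:: t, s & G]) :
      DG_axiom
        (All (Ex_st A) ==>> Ex_mst (s := t) (All (Ex_le v1 (fwk2 t A))))
  | ax_I s t (A : form [:: t, s & G]) : internal A ->
      DG_axiom
        (All_mst (s := t) (Ex (All_le v1 (fwk2 t A))) ==>> Ex (All_st A))
  | ax_IP s t (A : form (s :: G)) (B : form (t :: G)) : internal A ->
      DG_axiom
        ((All_mst A ==>> Ex_mst B) ==>>
         Ex_mst (s := t) (All_mst (fwk1 t A) ==>> Ex_mle v0 (fwk1 t B)))
  | ax_M s (A : form (s :: G)) (B : form G) : internal A -> internal B ->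
      DG_axiom
        ((All_mst A ==>> B) ==>>
         Ex_mst (s := s) (All_le v0 (fwk1 s A) ==>> fwk s B))
  | ax_MAJ s : DG_axiom (All_st (Ex_st (v1 <=* (v0 : tm [:: s, s & G] s)))).

Inductive DG_entails : forall G, seq (form G) -> form G -> Prop :=
  | axiom G H (A : form G) : DG_axiom A -> DG_entails H A
  | hyp G H (A : form G) : List.In A H -> DG_entails H A
  | botE G H (A : form G) : DG_entails H Bot -> DG_entails H A
  | andI G H (A B : form G) :
      DG_entails H A -> DG_entails H B -> DG_entails H (A &&& B)
  | andEl G H (A B : form G) : DG_entails H (A &&& B) -> DG_entails H A
  | andEr G H (A B : form G) : DG_entails H (A &&& B) -> DG_entails H B
  | orIl G H (A B : form G) : DG_entails H A -> DG_entails H (A ||| B)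
  | orIr G H (A B : form G) : DG_entails H B -> DG_entails H (A ||| B)
  | orE G H (A B C : form G) :
      DG_entails H (A ||| B) -> DG_entails (A :: H) C -> DG_entails (B :: H) C ->
      DG_entails H C
  | impI G H (A B : form G) : DG_entails (A :: H) B -> DG_entails H (A ==>> B)
  | impE G H (A B : form G) :
      DG_entails H (A ==>> B) -> DG_entails H A -> DG_entails H B
  | allI G H s (A : form (s :: G)) :
      DG_entails (map (@fwk G s) H) A -> DG_entails H (All A)
  | allE G H s (A : form (s :: G)) (t : tm G s) :
      DG_entails H (All A) -> DG_entails H (inst_form A t)
  | exI G H s (A : form (s :: G)) (t : tm G s) :
      DG_entails H (inst_form A t) -> DG_entails H (Ex A)
  | exE G H s (A : form (s :: G)) (B : form G) :
      DG_entails H (Ex A) -> DG_entails (A :: map (@fwk G s) H) (fwk s B) ->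
      DG_entails H B.

Definition DG_proves (A : form [::]) : Prop := DG_entails [::] A.

(* phi_{e,s}(n) = m; see [tTM_correct]. *)
Definition phi G (e s n m : tm G N) : form G := cl tTM $ e $ s $ n === Succ $ m.

(* Below, [f], [e], [n], [m], [s] are the variables bound in this order. *)
Definition CT : form [::] :=
  All (s := N ~> N) (Ex (s := N) (All (s := N) (All (s := N)
    (Ex (s := N) (phi v3 v0 v2 v1) <<=>> v3 $ v1 === v0)))).

Definition CT_st : form [::] :=
  All_st (s := N ~> N) (Ex_st (s := N) (All_st (s := N) (All_st (s := N)
    (Ex_st (s := N) (phi v3 v0 v2 v1) <<=>> v3 $ v1 === v0)))).

(* Main.v *)
(** Every function bounded by 1 is majorized by a constant, hence standard, so
    CT^st gives each binary function a standard index.  By R the index is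
    bounded by one standard z: writing Th(e) for "machine e halts on input e
    with output 0 in standardly many steps", every x has some e <= z with
    Th(e) <-> x e = 0.  This is refuted by diagonalization, with external
    induction on z: to go from z to z + 1 it suffices to change x at one point,
    according to whether Th holds there, a case distinction that is harmless
    because the goal is absurdity.  Nothing about Turing machines is used, so
    [tTM] is replaced by an arbitrary closed term. *)

From mathcomp Require Import all_boot.
Require Import Defs.
From Stdlib Require List.
Set Implicit Arguments.
Unset Strict Implicit.
Unset Printing Implicit Defensive.
Local Open Scope dg_scope.

(** * Substitution in terms *)

Lemma tsub_ext G D (f g : tsubst G D) : (forall s x, f s x = g s x) ->
  forall s (t : tm G s), tsub f t = tsub g t.
Proof. by move=> fg s; elim=> //= [? ? ? -> ? ->]. Qed.

Lemma tsub_comp G D K (f : tsubst G D) (g : tsubst D K) s (t : tm G s) :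
  tsub g (tsub f t) = tsub (fun s x => tsub g (f s x)) t.
Proof. by elim: t => //= ? ? ? -> ? ->. Qed.

Lemma tsub_Var G s (t : tm G s) : tsub (@Var G) t = t.
Proof. by elim: t => //= ? ? ? -> ? ->. Qed.

Lemma tsub_app G D (f : tsubst G D) s t (u : tm G (s ~> t)) v :
  tsub f (u $ v) = tsub f u $ tsub f v.
Proof. by []. Qed.

Lemma tsub_cl G D (f : tsubst G D) s (t : tm [::] s) : tsub f (cl t) = cl t.
Proof.
rewrite /cl tsub_comp; apply: tsub_ext => r x.
exact: (vnil (fun r x => tsub f (vnil _ r x) = vnil _ r x)).
Qed.

Lemma tsub_scons_twk G D r (a : tm D r) (f : tsubst G D) s (t : tm G s) :
  tsub (scons a f) (twk r t) = tsub f t.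
Proof. by rewrite /twk tsub_comp; apply: tsub_ext. Qed.

Lemma tsub_inst_twk G r (a : tm G r) s (t : tm G s) : tsub (inst a) (twk r t) = t.
Proof. by rewrite tsub_scons_twk tsub_Var. Qed.

Lemma tsub_up_twk G D r (f : tsubst G D) s (t : tm G s) :
  tsub (up r f) (twk r t) = twk r (tsub f t).
Proof. by rewrite tsub_scons_twk /twk tsub_comp. Qed.

Lemma tsub_shift G r s (t : tm G s) : tsub (shift G r) t = twk r t.
Proof. by []. Qed.

Lemma twk_app G r s t (u : tm G (s ~> t)) v : twk r (u $ v) = twk r u $ twk r v.
Proof. by []. Qed.

Lemma twk_Var G r s (x : var G s) : twk r (Var x) = Var (vs x).
Proof. by []. Qed.

Lemma twk_Zero G r : twk r (Zero : tm G N) = Zero.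
Proof. by []. Qed.

Lemma twk_Succ G r : twk r (Succ : tm G (N ~> N)) = Succ.
Proof. by []. Qed.

Lemma twk_cl G r s (t : tm [::] s) : twk r (cl t : tm G s) = cl t.
Proof. exact: tsub_cl. Qed.

Lemma shiftE G r s (x : var G s) : shift G r s x = Var (vs x).
Proof. by []. Qed.

(** The order matters: [up] and [inst] unfold to [scons], so [tsub_scons_twk] would also match them
    and has to come after their own rules. *)
Definition tsubE :=
  (tsub_cl, twk_cl, tsub_up_twk, tsub_inst_twk, tsub_scons_twk, tsub_shift,
   shiftE, twk_app, twk_Var, twk_Zero, twk_Succ).

Lemma fsub_eqT G D (f : tsubst G D) s (x y : tm G s) :
  fsub f (x =*= y) = (tsub f x =*= tsub f y).
Proof.
by elim: s G D f x y => //= r _ s IH G D f x y; rewrite IH /= !tsub_up_twk.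
Qed.

(** * Equality at all finite types *)

Section Rules.
Context (G : ctx) (H : seq (form G)).

Lemma impE_axiom (A B : form G) : DG_axiom (A ==>> B) -> DG_entails H A -> DG_entails H B.
Proof. by move=> /(axiom H) AB; apply: impE. Qed.

Lemma eq_arg s t (f : tm G (s ~> t)) x y :
  DG_entails H (x =*= y) -> DG_entails H (f $ x =*= f $ y).
Proof. exact: impE_axiom (ax_ext f x y). Qed.

Lemma eq_fun s t (f g : tm G (s ~> t)) x :
  DG_entails H (f =*= g) -> DG_entails H (f $ x =*= g $ x).
Proof.
move=> /(@allE _ _ _ _ x).
by rewrite /inst_form fsub_eqT /= !tsub_inst_twk.
Qed.

End Rules.

Lemma eqT_refl G H s (x : tm G s) : DG_entails H (x =*= x).
Proof.
elim: s G H x => [|r _ s IH] G H x; first exact/axiom/ax_refl.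
exact/allI/IH.
Qed.

(** Stated as an implication inside the system: at an arrow type the assumed equation is then a
    hypothesis, which [allI] carries along to the larger context. *)
Lemma eqT_sym_imp G H s (x y : tm G s) : DG_entails H (x =*= y ==>> y =*= x).
Proof.
elim: s G H x y => [|r _ s IH] G H x y; first exact/axiom/ax_sym.
apply/impI/allI/(impE (IH _ _ _ _))/eq_fun/hyp; left.
by rewrite /fwk fsub_eqT.
Qed.

Lemma eqT_trans_imp G H s (x y z : tm G s) :
  DG_entails H (x =*= y ==>> y =*= z ==>> x =*= z).
Proof.
elim: s G H x y z => [|r _ s IH] G H x y z; first exact/axiom/ax_trans.
apply/impI/impI/allI.
apply: (impE (impE (IH _ _ _ (twk r y $ v0) _) _)); apply/eq_fun/hyp.
- by right; left; rewrite /fwk fsub_eqT.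
- by left; rewrite /fwk fsub_eqT.
Qed.

Lemma eqT_sym G H s (x y : tm G s) : DG_entails H (x =*= y) -> DG_entails H (y =*= x).
Proof. exact/impE/eqT_sym_imp. Qed.

Lemma eqT_trans G H s (y x z : tm G s) :
  DG_entails H (x =*= y) -> DG_entails H (y =*= z) -> DG_entails H (x =*= z).
Proof. by move=> xy; apply: impE; apply: impE xy; exact: eqT_trans_imp. Qed.

Lemma eq_app G H s t (f g : tm G (s ~> t)) x y :
  DG_entails H (f =*= g) -> DG_entails H (x =*= y) -> DG_entails H (f $ x =*= g $ y).
Proof.
by move=> fg xy; apply: (eqT_trans (y := g $ x)); [apply: eq_fun | apply: eq_arg].
Qed.

(** * Conversion rules for abstraction, recursion and truncated subtraction *)

(* [tsub f (lam t)] and [lam (tsub (up _ f) t)] differ syntactically: hence [f]. *)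
Lemma lam_beta G D (f : tsubst G D) H r s (t : tm (r :: G) s) (u : tm D r) :
  DG_entails H (tsub f (lam t) $ u =*= tsub (scons u f) t).
Proof.
have piE s' (c : tm D s') : DG_entails H (Pi $ c $ u =*= c) by exact/axiom/ax_Pi.
elim: t => [t x | s1 s2 t IHt t' IHu |||||]; try by move=> *; apply: piE.
- refine (vcase (fun t x =>
    DG_entails H (tsub f (lam (Var x)) $ u =*= scons u f _ x)) _ _ _ x) => //=.
  by apply: eqT_trans (axiom _ (ax_Sigma _ _ _)) _; exact/axiom/ax_Pi.
- by apply: eqT_trans (axiom _ (ax_Sigma _ _ _)) _; exact: eq_app.
Qed.

Section Eq0.
Context (G : ctx) (H : seq (form G)).
Implicit Types x y z : tm G N.

Lemma eq0_sym x y : DG_entails H (x === y) -> DG_entails H (y === x).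
Proof. exact: (@eqT_sym _ _ N). Qed.

Lemma eq0_trans y x z :
  DG_entails H (x === y) -> DG_entails H (y === z) -> DG_entails H (x === z).
Proof. exact: (@eqT_trans _ _ N). Qed.

Lemma eq0_refl x : DG_entails H (x === x).
Proof. exact: (@eqT_refl _ _ N). Qed.

Lemma eq0_arg s (f : tm G (s ~> N)) (x y : tm G s) :
  DG_entails H (x =*= y) -> DG_entails H (f $ x === f $ y).
Proof. exact: (@eq_arg _ _ _ N). Qed.

End Eq0.

Lemma lam2_beta G D (f : tsubst G D) H r r' s (t : tm (r' :: r :: G) s)
    (u : tm D r) (v : tm D r') :
  DG_entails H (tsub f (lam (lam t)) $ u $ v =*= tsub (scons v (scons u f)) t).
Proof. by apply: eqT_trans (lam_beta _ _ _ _); apply: eq_fun; apply: lam_beta. Qed.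

(** The counter has only to be provably 0, or provably a successor in [rec0_S], so that open terms
    can be treated after a case distinction. *)
Lemma rec0_0 G D (f : tsubst G D) H n y z :
  DG_entails H (tsub f n === Zero) ->
  DG_entails H (tsub f (rec0 n y z) === tsub f y).
Proof.
move=> n0; apply: eq0_trans (axiom _ (@ax_Rec0 _ N _ _)).
exact/(@eq_fun _ _ _ N)/eq_fun/eq_arg.
Qed.

(** The previous value is spelled out with [Rec] because substitution does not commute with
    [lam]. *)
Lemma rec0_S G D (f : tsubst G D) H n y z k :
  DG_entails H (tsub f n === Succ $ k) ->
  DG_entails H (tsub f (rec0 n y z) ===
    tsub (scons k (scons (Rec $ k $ tsub f y $ tsub f (lam (lam z))) f)) z).
Proof.
move=> nS; apply: eq0_trans (lam2_beta f _ (s := N) _ _ _).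
apply: eq0_trans (axiom _ (@ax_RecS _ N _ _ _)).
exact/(@eq_fun _ _ _ N)/eq_fun/eq_arg.
Qed.

Section Monus.
Context (G : ctx) (H : seq (form G)).
Implicit Types x y : tm G N.

Lemma pred_0 : DG_entails H (cl tpred $ Zero === Zero).
Proof.
apply: eq0_trans (lam_beta _ _ (s := N) _ _) _.
exact/rec0_0/eq0_refl.
Qed.

Lemma pred_S x : DG_entails H (cl tpred $ (Succ $ x) === x).
Proof.
apply: eq0_trans (lam_beta _ _ (s := N) _ _) _.
exact/rec0_S/eq0_refl.
Qed.

Lemma monus_0 x : DG_entails H (cl tmonus $ x $ Zero === x).
Proof.
apply: eq0_trans (lam2_beta _ _ (s := N) _ _ _) _.
exact/rec0_0/eq0_refl.
Qed.

Lemma monus_S x y :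
  DG_entails H (cl tmonus $ x $ (Succ $ y) === cl tpred $ (cl tmonus $ x $ y)).
Proof.
apply: eq0_trans (lam2_beta _ _ (s := N) _ _ _) _.
apply: eq0_trans; first exact/(@rec0_S _ _ _ _ _ _ _ y)/eq0_refl.
rewrite tsub_app tsub_cl; apply: eq0_arg.
exact/eq0_sym/(lam2_beta _ _ (s := N)).
Qed.

End Monus.

#[local] Opaque cl lam rec0.

(** * Weakening of the list of hypotheses *)

Lemma incl_map (T U : Type) (f : T -> U) H H' :
  List.incl H H' -> List.incl (map f H) (map f H').
Proof. by move=> HH y /List.in_map_iff[x [<- Hx]]; apply/List.in_map/HH. Qed.

Lemma incl_cons2 (T : Type) (a : T) H H' :
  List.incl H H' -> List.incl (a :: H) (a :: H').
Proof. by move=> HH x [<- | Hx]; [left | right; apply: HH]. Qed.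

Lemma weaken G H H' (A : form G) :
  DG_entails H A -> List.incl H H' -> DG_entails H' A.
Proof.
move=> HA; elim: HA H' => {G H A}.
- by move=> *; apply: axiom.
- by move=> G H A HA H' HH; apply/hyp/HH.
- by move=> G H A _ IH H' /IH; apply: botE.
- by move=> G H A B _ IHA _ IHB H' HH; apply: andI; auto.
- by move=> G H A B _ IH H' /IH; apply: andEl.
- by move=> G H A B _ IH H' /IH; apply: andEr.
- by move=> G H A B _ IH H' /IH; apply: orIl.
- by move=> G H A B _ IH H' /IH; apply: orIr.
- by move=> G H A B C _ IH _ IHA _ IHB H' HH; apply: (orE (IH _ HH));
    [apply: IHA | apply: IHB]; apply: incl_cons2.
- by move=> G H A B _ IH H' HH; apply/impI/IH/incl_cons2.
- by move=> G H A B _ IHA _ IHB H' HH; apply: impE (IHA _ HH) (IHB _ HH).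
- by move=> G H s A _ IH H' HH; apply/allI/IH/incl_map.
- by move=> G H s A t _ IH H' /IH; apply: allE.
- by move=> G H s A t _ IH H' /IH; apply: exI.
- move=> G H s A B _ IHA _ IHB H' HH; apply: (exE (IHA _ HH)).
  exact/IHB/incl_cons2/incl_map.
Qed.

Lemma weaken1 G H (A B : form G) : DG_entails H A -> DG_entails (B :: H) A.
Proof. by move/weaken; apply; right. Qed.

Lemma hyp0 G H (A : form G) : DG_entails (A :: H) A.
Proof. by apply: hyp; left. Qed.

Lemma hyp1 G H (A B : form G) : DG_entails [:: B, A & H] A.
Proof. exact/weaken1/hyp0. Qed.

Lemma hyp2 G H (A B C : form G) : DG_entails [:: C, B, A & H] A.
Proof. exact/weaken1/hyp1. Qed.

(** * Arithmetic by internal induction *)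

Lemma internal_ind G H (A : form (N :: G)) : internal A ->
  DG_entails H (inst_form A Zero) -> DG_entails H (All (A ==>> succ_form A)) ->
  DG_entails H (All A).
Proof.
move=> iA A0 AS; apply: impE (axiom _ (ax_ind iA)) _; exact: andI.
Qed.

(** The formula is internal, so induction makes this case distinction available at all numbers,
    nonstandard ones included. *)
Lemma eq0_case G H (x : tm G N) :
  DG_entails H (x === Zero ||| x === Succ $ (cl tpred $ x)).
Proof.
suff /(@allE _ _ _ _ x): DG_entails H
  (All (v0 === Zero ||| v0 === Succ $ (cl tpred $ v0))).
  by rewrite /inst_form /= tsub_cl.
apply: internal_ind => //; rewrite /inst_form /succ_form /= ?tsub_cl.
  exact/orIl/eq0_refl.
apply/allI/impI/orIr; rewrite /succ_form /= ?tsub_cl.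
exact/eq0_arg/eq0_sym/pred_S.
Qed.

Lemma eq0_succ_inj G H (x y : tm G N) :
  DG_entails H (Succ $ x === Succ $ y) -> DG_entails H (x === y).
Proof. exact: impE_axiom (ax_succ_inj _ _). Qed.

Lemma succ_neq0 G H (x : tm G N) A :
  DG_entails H (Succ $ x === Zero) -> DG_entails H A.
Proof. by move=> x0; apply: botE; apply: impE (axiom _ (ax_succ_neq0 x)) x0. Qed.

Lemma pred_eqS G H (x y : tm G N) :
  DG_entails H (cl tpred $ x === Succ $ y) ->
  DG_entails H (x === Succ $ (Succ $ y)).
Proof.
move=> xy; apply: (orE (eq0_case H x)).
- apply: (@succ_neq0 _ _ y); apply: eq0_trans _ (pred_0 _).
  apply: eq0_trans (eq0_sym (weaken1 _ xy)) _.
  exact/eq0_arg/hyp0.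
- apply: eq0_trans (hyp0 _ _) _.
  exact/eq0_arg/weaken1.
Qed.

Lemma pred_eq0 G H (x : tm G N) :
  DG_entails H (cl tpred $ x === Zero) ->
  DG_entails H (x === Zero ||| x === Succ $ Zero).
Proof.
move=> x0; apply: (orE (eq0_case H x)).
- exact/orIl/hyp0.
- apply/orIr/(eq0_trans (hyp0 _ _)).
  exact/eq0_arg/weaken1.
Qed.

(** Induction on [i], with [k] quantified inside [A] because x - (i + 1) = k + 1 turns into x - i =
    k + 2. For k = 0 it makes the e with (e + 1) - z = 1 unique. *)
Lemma monus_inj G H (x y i k : tm G N) :
  DG_entails H (cl tmonus $ x $ i === Succ $ k) ->
  DG_entails H (cl tmonus $ y $ i === Succ $ k) -> DG_entails H (x === y).
Proof.
pose A : form (N :: G) := All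
  (cl tmonus $ twk N (twk N x) $ v1 === Succ $ v0 ==>>
   cl tmonus $ twk N (twk N y) $ v1 === Succ $ v0 ==>>
   twk N (twk N x) === twk N (twk N y)).
have: DG_entails H (All A).
  apply: internal_ind => //.
    rewrite /inst_form /= !tsubE.
    apply/allI/impI/impI.
    apply: (@eq0_trans _ _ (Succ $ v0)).
      apply: eq0_trans (eq0_sym (monus_0 _ _)) _.
      exact: hyp1.
    apply: eq0_sym.
    apply: eq0_trans (eq0_sym (monus_0 _ _)) _.
    exact/hyp0.
  apply/allI/impI/allI/impI/impI; rewrite /succ_form /= /fwk /= !tsubE.
  set K := [:: _, _, _ & _].
  have /(allE (Succ $ v0)) : DG_entails K _ := hyp2 _ _ _ _.
  rewrite /inst_form /= !tsubE => HK.
  have step t : DG_entails K (cl tmonus $ t $ (Succ $ v1) === Succ $ v0) ->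
      DG_entails K (cl tmonus $ t $ v1 === Succ $ (Succ $ v0)).
    by move=> Ht; apply/pred_eqS/eq0_trans/Ht/eq0_sym/monus_S.
  apply: impE (impE HK (step _ _)) (step _ _).
    exact: hyp1.
  exact: hyp0.
move=> /(allE i); rewrite /inst_form /= !tsubE => /(allE k).
rewrite /inst_form /= !tsubE => HA xk yk.
exact: impE (impE HA xk) yk.
Qed.

Lemma monus_SS G H (x y : tm G N) :
  DG_entails H (cl tmonus $ (Succ $ x) $ (Succ $ y) === cl tmonus $ x $ y).
Proof.
suff /(allE y): DG_entails H (All
  (cl tmonus $ (Succ $ twk N x) $ (Succ $ v0) === cl tmonus $ twk N x $ v0)).
  by rewrite /inst_form /= !tsubE.
apply: internal_ind => //; rewrite /inst_form /succ_form /= !tsubE.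
  apply: eq0_trans (monus_S _ _ _) _; apply: eq0_trans _ (eq0_sym (monus_0 _ _)).
  apply: eq0_trans _ (pred_S _ _); apply/eq0_arg/monus_0.
apply/allI/impI.
apply: eq0_trans (monus_S _ _ _) _; apply: eq0_trans _ (eq0_sym (monus_S _ _ _)).
exact/eq0_arg/hyp0.
Qed.

(** * Functions defined by cases *)

(* [u] is kept abstract, and [f] present, because [lam] does not commute with
   substitution. *)
Lemma ex_update G (x : tm G (N ~> N)) (z : tm G N) (b : tm [::] N) :
  exists u : tm G (N ~> N), forall D (f : tsubst G D) H (e : tm D N),
    (DG_entails H (cl tmonus $ (Succ $ e) $ tsub f z === Zero) ->
     DG_entails H (tsub f u $ e === tsub f x $ e)) /\
    (forall k, DG_entails H (cl tmonus $ (Succ $ e) $ tsub f z === Succ $ k) ->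
     DG_entails H (tsub f u $ e === cl b)).
Proof.
(* The value is that of [x] for e < z and [b] for every e from z on; among the indices e <= z, this
   changes [x] at z only. *)
exists (lam (rec0 (cl tmonus $ (Succ $ v0) $ twk N z) (twk N x $ v0) (cl b))).
move=> D f H e; split=> [|k] ez.
- apply: eq0_trans; first exact: (lam_beta _ _ (s := N)).
  apply: eq0_trans; first by apply: rec0_0; rewrite /= !tsubE; exact: ez.
  by rewrite /= !tsubE; apply: eq0_refl.
- apply: eq0_trans; first exact: (lam_beta _ _ (s := N)).
  apply: eq0_trans; first by apply: rec0_S; rewrite /= !tsubE; exact: ez.
  by rewrite tsubE; apply: eq0_refl.
Qed.

(** The sign of [x]: a binary function with the same zeros, to which [st_binary] applies even if [x]
    is not standard. *)
Lemma ex_sg G (x : tm G (N ~> N)) :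
  exists u : tm G (N ~> N), forall D (f : tsubst G D) H (e : tm D N),
    (DG_entails H (tsub f x $ e === Zero) ->
     DG_entails H (tsub f u $ e === Zero)) /\
    (forall k, DG_entails H (tsub f x $ e === Succ $ k) ->
     DG_entails H (tsub f u $ e === Succ $ Zero)).
Proof.
exists (lam (rec0 (twk N x $ v0) Zero (Succ $ Zero))).
move=> D f H e; split=> [|k] ez.
- apply: eq0_trans; first exact: (lam_beta _ _ (s := N)).
  by apply: rec0_0; rewrite /= !tsubE.
- apply: eq0_trans; first exact: (lam_beta _ _ (s := N)).
  by apply: rec0_S; rewrite /= !tsubE; exact: ez.
Qed.

Lemma iff_trans G H (A B C : form G) : DG_entails H (A <<=>> B) ->
  DG_entails H (B <<=>> C) -> DG_entails H (A <<=>> C).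
Proof.
move=> AB BC; apply: andI; apply: impI.
- apply: impE (weaken1 _ (andEl BC)) _; exact: impE (weaken1 _ (andEl AB)) (hyp0 _ _).
- apply: impE (weaken1 _ (andEr AB)) _; exact: impE (weaken1 _ (andEr BC)) (hyp0 _ _).
Qed.

Lemma eq0_iff G H (x y z : tm G N) :
  DG_entails H (x === y) -> DG_entails H (x === z <<=>> y === z).
Proof.
move=> xy; apply: andI; apply: impI.
- by apply: eq0_trans (hyp0 _ _); apply/eq0_sym/weaken1.
- by apply: eq0_trans (hyp0 _ _); apply/weaken1.
Qed.

(** * Diagonalization against a bounded set of indices *)

Section Diagonal.
Variable T : tm [::] (N ~> N ~> N ~> N).

(** By the coding of [phi], the value [Succ $ Zero] means output 0. The standard step count makes
    the formula external, so internal induction does not apply to it. *)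
Definition halt0 G (e : tm G N) : form G :=
  Ex_st (s := N) (cl T $ twk N e $ v0 $ twk N e === Succ $ Zero).

Lemma fsub_halt0 G D (f : tsubst G D) e : fsub f (halt0 e) = halt0 (tsub f e).
Proof. by rewrite /halt0 /= !tsubE. Qed.

Lemma halt0_eq G H (e e' : tm G N) :
  DG_entails H (e === e' ==>> halt0 e ==>> halt0 e').
Proof.
apply/impI/impI/(exE (hyp0 _ _)); rewrite /fwk fsub_halt0 tsubE.
apply: (exI (t := v0)); rewrite /inst_form /= !tsubE.
apply: andI; first exact/andEl/hyp0.
apply: eq0_trans (andEr (hyp0 _ _)).
have ee : DG_entails [:: St v0 &&& cl T $ twk N e $ v0 $ twk N e === Succ $ Zero,
    halt0 (twk N e), twk N e === twk N e' & map (fsub (shift G N)) H]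
  (twk N e' === twk N e) by exact/eq0_sym/hyp2.
by apply: (@eq_app _ _ N N) => //; apply: eq_fun; exact: (@eq_arg _ _ N _ _ (twk N e')).
Qed.

#[local] Opaque halt0.

(* [Succ $ e -. z = 0] encodes [e < z], so that the case [z = 0] is void. *)
Definition bounded G (z : tm G N) : form G :=
  All (s := N ~> N) (Ex (s := N)
    (cl tmonus $ (Succ $ v0) $ twk N (twk (N ~> N) z) === Zero &&&
     (halt0 v0 <<=>> v1 $ v0 === Zero))).

Lemma fsub_bounded G D (f : tsubst G D) z : fsub f (bounded z) = bounded (tsub f z).
Proof. by rewrite /bounded /= !fsub_halt0 !tsubE. Qed.

Lemma boundedE G (H : seq (form G)) z x : DG_entails H (bounded z) ->
  DG_entails H (Ex (s := N) (cl tmonus $ (Succ $ v0) $ twk N z === Zero &&&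
     (halt0 v0 <<=>> twk N x $ v0 === Zero))).
Proof.
by move=> /(allE x); rewrite /inst_form /= !fsub_halt0 !tsubE.
Qed.

Lemma boundedI G (H : seq (form G)) z :
  DG_entails (map (@fwk _ _) H) (Ex (s := N)
    (cl tmonus $ (Succ $ v0) $ twk N (twk (N ~> N) z) === Zero &&&
     (halt0 v0 <<=>> v1 $ v0 === Zero))) -> DG_entails H (bounded z).
Proof. exact: allI. Qed.

#[local] Opaque bounded.

Lemma bounded_0 G H : DG_entails H (bounded (Zero : tm G N) ==>> Bot).
Proof.
(* Any function can be tried here: the index e obtained satisfies e + 1 = (e + 1) - 0 = 0. *)
apply/impI/(exE (boundedE (Pi $ Zero) (hyp0 _ _))).
apply: (succ_neq0 (x := v0)).
by apply: eq0_trans (eq0_sym (monus_0 _ _)) (andEl (hyp0 _ _)).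
Qed.

(** Given [x], the bound z + 1 is applied to the function that agrees with [x] below z and takes the
    value [b] at z. The assumption on [b] keeps the resulting index from being z, encoded as (e + 1)
    - z = 1; so it lies below z and serves [x] as well. *)
Lemma bounded_pred G H (z : tm G N) (b : tm [::] N) :
  DG_entails H
    (bounded (Succ $ z) ==>>
     All (s := N) (cl tmonus $ (Succ $ v0) $ twk N z === Succ $ Zero ==>>
       (halt0 v0 <<=>> cl b === Zero) ==>> Bot) ==>>
     bounded z).
Proof.
apply/impI/impI/boundedI; rewrite /= /fwk /= fsub_halt0 fsub_bounded /= !tsubE.
have [u uP] := ex_update v0 (twk (N ~> N) z) b.
apply: (exE (boundedE u (hyp1 _ _ _))).
rewrite /= /fwk /= !fsub_halt0 fsub_bounded /= !tsubE.
set K := [:: _, _, _ & _].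
have [h0 hh] : DG_entails K
     (cl tmonus $ (Succ $ v0) $ (Succ $ twk N (twk (N ~> N) z)) === Zero) /\
   DG_entails K (halt0 v0 <<=>> twk N u $ v0 === Zero).
  by split; [apply: andEl | apply: andEr]; apply: hyp0.
(* As (e + 1) - (z + 1) = 0 is the predecessor of (e + 1) - z, the latter is 0 (e < z) or 1 (e =
   z). *)
apply: orE (pred_eq0 (eq0_trans (eq0_sym (monus_S _ _ _)) h0)) _ _.
- apply: (exI (t := v0)); rewrite /inst_form /= fsub_halt0 /= !tsubE.
  apply: andI (hyp0 _ _) (iff_trans (weaken1 _ hh) (eq0_iff _ _)).
  by apply: (proj1 (uP _ (shift _ N) _ _)); exact: hyp0.
- apply: botE.
  have : DG_entails K (All (cl tmonus $ (Succ $ v0) $ twk N (twk N (twk (N ~> N) z)) ===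
     Succ $ Zero ==>> (halt0 v0 <<=>> cl b === Zero) ==>> Bot)) by exact: hyp1.
  move=> /(allE v0); rewrite /inst_form /= !fsub_halt0 /= !tsubE => h.
  apply: (impE (impE (weaken1 _ h) (hyp0 _ _))).
  apply: iff_trans (weaken1 _ hh) (eq0_iff _ _).
  by apply: (proj2 (uP _ (shift _ N) _ _)); exact: hyp0.
Qed.

(** If Th(z) holds, the value 1 at z excludes z, since the equivalence would give 1 = 0. *)
Lemma bounded_pred_mark G H (z : tm G N) :
  DG_entails H
    (All (s := N) (cl tmonus $ (Succ $ v0) $ twk N z === Succ $ Zero ==>> halt0 v0) ==>>
     bounded (Succ $ z) ==>> bounded z).
Proof.
apply/impI/impI/(impE (impE (bounded_pred _ _ (Succ $ Zero)) (hyp0 _ _))).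
apply/allI/impI/impI; rewrite /= /fwk /= !fsub_halt0 fsub_bounded /= !tsubE.
apply: (@succ_neq0 _ _ Zero).
apply: impE (andEl (hyp0 _ _)) _.
set K := [:: _, _, _, _ & _].
have : DG_entails K (All (s := N) (cl tmonus $ (Succ $ v0) $ twk N (twk N z) ===
  Succ $ Zero ==>> halt0 v0)) by apply/weaken1/hyp2.
move=> /(allE v0); rewrite /inst_form /= !fsub_halt0 /= !tsubE => /impE; apply.
exact: hyp1.
Qed.

(** If Th(z) fails, the value 0 at z excludes z, since 0 = 0 would give Th(z). *)
Lemma bounded_pred_unmark G H (z : tm G N) :
  DG_entails H
    (All (s := N) (cl tmonus $ (Succ $ v0) $ twk N z === Succ $ Zero ==>>
       Neg (halt0 v0)) ==>>
     bounded (Succ $ z) ==>> bounded z).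
Proof.
apply/impI/impI/(impE (impE (bounded_pred _ _ Zero) (hyp0 _ _))).
apply/allI/impI/impI; rewrite /= /fwk /= !fsub_halt0 fsub_bounded /= !tsubE.
set K := [:: _, _, _, _ & _].
have : DG_entails K (All (s := N) (cl tmonus $ (Succ $ v0) $ twk N (twk N z) ===
  Succ $ Zero ==>> Neg (halt0 v0))) by apply/weaken1/hyp2.
move=> /(allE v0); rewrite /inst_form /= !fsub_halt0 /= !tsubE => /impE h.
apply: impE (h (hyp1 _ _ _)) (impE (andEr (hyp0 _ _)) _).
exact: eq0_refl.
Qed.

(** Intuitionistic form of the case distinction on Th(z): assuming the bound z + 1 and not z,
    [bounded_pred_mark] refutes Th(z), after which [bounded_pred_unmark] yields the
    contradiction. *)
Lemma bounded_step G H (z : tm G N) :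
  DG_entails H (Neg (bounded z) ==>> Neg (bounded (Succ $ z))).
Proof.
apply/impI/impI/(impE (hyp1 _ _ _)).
apply: impE (impE (bounded_pred_unmark _ _) _) (hyp0 _ _).
apply/allI/impI/impI; rewrite /= /fwk /= !fsub_bounded /= !tsubE.
set K := [:: _, _, _, _ & _].
have nz : DG_entails K (Neg (bounded (twk N z))) by apply/weaken1/hyp2.
have Sz : DG_entails K (bounded (Succ $ twk N z)) by apply: hyp2.
apply: impE nz (impE (impE (bounded_pred_mark _ _) _) Sz).
apply/allI/impI; rewrite /= /fwk /= !fsub_halt0 !fsub_bounded /= !tsubE.
(* Both [v1] and [v0] satisfy (e + 1) - z = 1, so they are equal and Th passes from [v1] to [v0]. *)
apply: (impE (impE (halt0_eq _ v1 _) _) (hyp1 _ _ _)).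
apply/eq0_succ_inj/monus_inj/hyp0; exact: hyp2.
Qed.

(** [bounded] contains [St] through [halt0], so the induction is external and reaches the standard
    z. *)
Lemma unbounded G H : DG_entails H (All_st (Neg (bounded (v0 : tm (N :: G) N)))).
Proof.
apply: impE (axiom _ (ax_ind_st _)) (andI _ _).
  by rewrite /inst_form /= fsub_bounded /=; apply: bounded_0.
apply/allI/impI; rewrite /succ_form /= fsub_bounded /=; exact: bounded_step.
Qed.

(** * From Church's thesis to a bounded set of indices *)

(** The constant function 1 is a closed term, hence standard, and strongly majorizes [u].
    Majorization is checked at fresh variables, which is why the assumption ranges over
    substitutions [f]. *)
Lemma st_binary G H (u : tm G (N ~> N)) :
  (forall D (f : tsubst G D) K e, DG_entails K
     (tsub f u $ e === Zero ||| tsub f u $ e === Succ $ Zero)) ->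
  DG_entails H (St u).
Proof.
move=> u01; apply: impE (impE (axiom _ (ax_st_maj _ _)) _) _.
  exact: (axiom _ (ax_st_closed _ (Pi $ (Succ $ Zero)))).
have one D K (e : tm D N) :
    DG_entails K (cl (Pi $ (Succ $ Zero)) $ e === Succ $ Zero).
  exact: (axiom _ (@ax_Pi _ N _ _ _)).
have le1 D K (x e : tm D N) : DG_entails K (x === Zero ||| x === Succ $ Zero) ->
    DG_entails K (le0 x (cl (Pi $ (Succ $ Zero)) $ e)).
  move=> x01; apply: eq0_trans (@eq0_arg _ _ N _ _ _ (one _ _ _)) _.
  apply: (orE x01).
  - apply: eq0_trans (monus_S _ _ _) _; apply: eq0_trans _ (pred_0 _); apply: eq0_arg.
    exact: eq0_trans (monus_0 _ _) (hyp0 _ _).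
  - apply: eq0_trans _ (monus_0 _ _); apply: eq0_trans _ (monus_SS _ _ _).
    exact/(@eq_fun _ _ _ N)/eq_arg/hyp0.
apply/allI/allI/impI; rewrite !twk_cl; apply: andI; apply: le1.
  have -> : twk N (twk N u) = tsub (fun s x => Var (vs (vs x))) u by apply: tsub_comp.
  exact: u01.
exact/orIr/one.
Qed.

(** Convertible to [CT_st] when [T] is [tTM] and the context is empty. *)
Definition CT_st_for G : form G :=
  All_st (s := N ~> N) (Ex_st (s := N) (All_st (s := N) (All_st (s := N)
    (Ex_st (s := N) (cl T $ v3 $ v0 $ v2 === Succ $ v1) <<=>> v3 $ v1 === v0)))).

(** The thesis is applied to the sign of [x], which is standard whatever [x] is; this is how the
    quantifier over [x] loses its restriction, as [ax_R] demands. *)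
Lemma CT_st_halt0 G H : DG_entails H (CT_st_for G ==>>
  All (s := N ~> N) (Ex_st (s := N) (halt0 v0 <<=>> v1 $ v0 === Zero))).
Proof.
apply/impI/allI; rewrite /= {1}/fwk /= !tsubE.
have [u uP] := ex_sg (v0 : tm (N ~> N :: G) (N ~> N)).
set K := [:: All _ & _].
have Stu : DG_entails K (St u).
  apply: st_binary => D f K' e; have [u0 u1] := uP D f K' e.
  apply: (orE (eq0_case _ (tsub f v0 $ e))).
  - apply/orIl/(proj1 (uP _ _ _ _))/hyp0.
  - apply/orIr/(proj2 (uP _ _ _ _))/hyp0.
have : DG_entails K (CT_st_for _) by exact: hyp0.
move=> /(allE u)/impE; rewrite /inst_form /=.
move=> /(_ Stu) h; apply: (exE h); rewrite /fwk /= !tsubE.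
set L := [:: _ &&& _, _ & _].
apply: (exI (t := v0)); rewrite /inst_form /= !fsub_halt0 /= ?tsubE.
have St0 : DG_entails L (St v0) by exact/andEl/hyp0.
apply: andI => //; apply: (@iff_trans _ _ _ (twk N u $ v0 === Zero)).
  (* The diagonal: the input is the index itself and the output is 0. *)
  have := allE v0 (andEr (hyp0 _ _) : DG_entails L (All _)).
  rewrite /inst_form /= !tsubE => /impE /(_ St0) /(allE Zero).
  rewrite /inst_form /= !tsubE => /impE; apply.
  exact: (axiom _ (ax_st_closed _ Zero)).
have [u0 _] := uP _ (shift _ N) (v1 $ v0 === Zero :: L) v0.
apply: andI; apply: impI; last exact/u0/hyp0.
apply: (orE (eq0_case _ (v1 $ v0))); first exact: hyp0.
apply: (succ_neq0 (x := Zero)); apply: eq0_trans (hyp1 _ _ _).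
exact/eq0_sym/(proj2 (uP _ (shift _ N) _ _))/hyp0.
Qed.

Lemma CT_st_for_inconsistent G H : DG_entails H (CT_st_for G ==>> Bot).
Proof.
apply/impI.
have R := impE (axiom _ (ax_R _)) (impE (CT_st_halt0 _) (hyp0 H _)).
apply: (exE R); rewrite /fwk2 /fwk /= !fsub_halt0 /= !tsubE.
set K := [:: _, _ & _].
have St0 : DG_entails K (St v0) by exact/andEl/hyp0.
(* The bound z from [ax_R] gives e <= z, while [bounded] asks for a strict inequality: hence the
   instance z + 1, standard because [Succ] is. *)
have := allE (Succ $ v0) (unbounded K).
rewrite /inst_form /= fsub_bounded /= => /impE h.
apply: impE (h _) _.
  by apply: impE (impE (axiom _ (ax_st_app _ _)) (axiom _ (ax_st_closed _ Succ))) St0.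
apply: boundedI; rewrite /fwk /Ex_le /= !fsub_halt0 /= !tsubE.
set L := [:: _ &&& _, _ & _].
have := allE v0 (andEr (andEr (hyp0 _ _)) : DG_entails L (All _)).
rewrite /inst_form /= !fsub_halt0 /= !tsubE => {}h.
apply: (exE h); rewrite /fwk /= !fsub_halt0 /= !tsubE.
apply: (exI (t := v0)); rewrite /inst_form /= !fsub_halt0 /= ?tsubE.
apply: andI; last exact/andEr/hyp0.
exact: eq0_trans (monus_SS _ _ _) (andEl (hyp0 _ _)).
Qed.

End Diagonal.

Theorem theorem3p19 : DG_proves (Neg CT_st).
Proof. exact: CT_st_for_inconsistent tTM _ _. Qed.
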